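(* Let $U\in O(n)$ be an arbitrary orthogonal matrix. There exists a signature matrix $D$ such that $$|\det(DU+I)|\ge 1.$$ Then (for such $D$) the Cayley transform $$C(DU):=(I-DU)(I+DU)^{-1}$$ is well defined and belongs to a fixed bounded subset (not depending on $U$) of the space $\mathfrak{so}(n)$ of skew-symmetric matrices. More precisely, $$\rho\big(C(DU)\big)\le 1+2^n.$$ In particular, the pivoted Cayley transform maps the entire orthogonal group $O(n)$ into a bounded subset of $\mathfrak{so}(n)$.
   Context: $O(n)$ is the group of real $n\times n$ matrices $U$ with $UU^T=U^TU=I$, where $I$ is the identity matrix. $\mathfrak{so}(n)$ is the space of real skew-symmetric $n\times n$ matrices. A signature matrix is an $n\times n$ diagonal matrix with all diagonal entries in $\{-1,1\}$. $\rho(\cdot)$ denotes the spectral radius (maximal absolute value of the complex eigenvalues). The Cayley transform $C(B)=(I-B)(I+B)^{-1}$ is well defined when $\det(B+I)\neq 0$. The pivoted Cayley transform is the assignment $U\mapsto C(DU)$, where for each $U\in O(n)$ a signature matrix $D$ (depending on $U$) with $|\det(DU+I)|\ge 1$ is chosen. *)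

(* Defs.v *)
From HB Require Import structures.
From mathcomp Require Import all_boot all_order all_algebra.
From mathcomp Require Import all_classical all_reals all_analysis.
From mathcomp.real_closed Require Export complex.

Set Implicit Arguments.
Unset Strict Implicit.
Unset Printing Implicit Defensive.

Import Order.TTheory GRing.Theory Num.Theory.
Import numFieldNormedType.Exports.

Local Open Scope classical_set_scope.
Local Open Scope ring_scope.

Section CayleyDefs.
Context {R : realType}.

Definition orthogonal_group (n : nat) : set 'M[R]_n :=
  [set U | U *m U^T = 1%:M /\ U^T *m U = 1%:M].

Definition so (n : nat) : set 'M[R]_n := [set A | A \is skewmx].

Definition signature_matrix (n : nat) : set 'M[R]_n :=
  [set D | is_diag_mx D /\ forall i, D i i = -1 \/ D i i = 1].

(* invmx is total, being the identity on singular matrices, so this is the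
   Cayley transform only when 1%:M + B \in unitmx. *)
Definition cayley (n : nat) (B : 'M[R]_n) : 'M[R]_n :=
  (1%:M - B) *m invmx (1%:M + B).

(* The spectrum is finite, so for 0 < n this supremum is a maximum; for n = 0
   the spectrum is empty and the value is 0. *)
Definition spectral_radius (n : nat) (A : 'M[R]_n) : R :=
  sup [set ComplexField.Normc.normc z |
       z in [set z : R[i] | eigenvalue (map_mx (real_complex R) A) z]].

Definition pivot (n : nat) (U D : 'M[R]_n) : Prop :=
  signature_matrix D /\ 1 <= `|\det (D *m U + 1%:M)|.

Definition pivot_choice (n : nat) (piv : 'M[R]_n -> 'M[R]_n) : Prop :=
  forall U, orthogonal_group U -> pivot U (piv U).

Definition pivoted_cayley (n : nat) (piv : 'M[R]_n -> 'M[R]_n) (U : 'M[R]_n) :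
    'M[R]_n :=
  cayley (piv U *m U).

End CayleyDefs.

Arguments orthogonal_group R n : clear implicits.
Arguments so R n : clear implicits.
Arguments signature_matrix R n : clear implicits.

(* Main.v *)
Require Import Defs.
From mathcomp Require Import all_boot all_order perm all_algebra.
From mathcomp Require Import all_classical all_reals all_analysis.
From mathcomp Require Import ring lra.

Import Order.TTheory GRing.Theory Num.Theory.
Import numFieldNormedType.Exports.

Local Open Scope classical_set_scope.
Local Open Scope ring_scope.

(** The function d |-> det (diag d * U + 1) is affine in each coordinate of d,
    so its value at d = 0, which is det 1 = 1, is its average over the sign
    vectors; some sign vector therefore gives a determinant that is at least 1
    ([det_sign_pivot]).

    Write V = D * U, again orthogonal, and suppose |det (1 + V)| >= 1.  Over the
    complex numbers det (1 + V) is the product of the n factors 1 + mu, where mu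
    runs over the eigenvalues of V.  These lie on the unit circle, so each factor
    has modulus at most 2, and a product of modulus at least 1 forces each single
    factor to satisfy |1 + mu| >= 2^(1-n) ([unitary_eigenvalue_add1_ge]).  An
    eigenvalue z of the Cayley transform C(V) is (1 - mu) / (1 + mu) for such a
    mu, that is 1 + z = 2 / (1 + mu); hence |1 + z| <= 2^n and |z| <= 1 + 2^n
    ([cayley_spectral_radius_le]).

    The same determinant bound controls the matrix C(V) itself: the entries of
    1 + V are at most 2, so Cramer's rule bounds those of its inverse, and
    C(V) = 2 (1 + V)^-1 - 1 ([cayley_entry_le]).  Together with skew-symmetry
    ([cayley_skew]) this puts C(V) in the set of skew matrices whose entries are
    bounded by a constant depending on n only. *)

(** * Choosing the signs *)

(** With the coordinates of [d] equal to signs below [k] and to 0 from [k] on,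
    the determinant is affine in the coordinate [k], so its value at 0 is the
    mean of its values at 1 and -1 and one of the two is at least as large. *)
Lemma det_sign_pivot (R : realFieldType) (n : nat) (A B : 'M[R]_n) :
  exists2 d : 'rV[R]_n, (forall i, d 0 i = -1 \/ d 0 i = 1)
    & \det B <= \det (diag_mx d *m A + B).
Proof.
have partial k : exists d : 'rV[R]_n,
    [/\ forall i : 'I_n, (i < k)%N -> d 0 i = -1 \/ d 0 i = 1,
        forall i : 'I_n, (k <= i)%N -> d 0 i = 0
      & \det B <= \det (diag_mx d *m A + B)].
  elim: k => [|k [d [dsign d0 detd]]].
    exists 0; split=> // [i _|]; first by rewrite mxE.
    by rewrite linear0 mul0mx add0r.
  have [nk|kn] := leqP n k.
    exists d; split=> // i ik.
      by apply: dsign; exact: leq_trans (ltn_ord i) nk.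
    by apply: d0; exact: ltnW.
  pose i0 := Ordinal kn.
  pose e (s : R) : 'rV[R]_n := \row_j if j == i0 then s else d 0 j.
  have detE : \det (diag_mx d *m A + B) =
      2^-1 * \det (diag_mx (e 1) *m A + B) +
      2^-1 * \det (diag_mx (e (-1)) *m A + B).
    (* the two matrices differ in row [i0] only, and [d 0 i0 = 0] makes that row
       the mean of theirs *)
    apply: (@determinant_multilinear _ _ _ _ _ i0).
    - apply/rowP => j; rewrite !mul_diag_mx !mxE eqxx d0 //=; lra.
    - apply/matrixP => i j.
      by rewrite !mul_diag_mx !mxE eq_sym (negbTE (neq_lift _ _)).
    - apply/matrixP => i j.
      by rewrite !mul_diag_mx !mxE eq_sym (negbTE (neq_lift _ _)).
  have es s : s = -1 \/ s = 1 ->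
      (forall i : 'I_n, (i < k.+1)%N -> e s 0 i = -1 \/ e s 0 i = 1) /\
      (forall i : 'I_n, (k.+1 <= i)%N -> e s 0 i = 0).
    move=> s1; split=> i; rewrite mxE -val_eqE /=.
      by rewrite ltnS leq_eqVlt; case: eqP => //= _; exact: dsign.
    by move=> ki; rewrite gtn_eqF // d0 // ltnW.
  have [det1|detN1] := leP (\det B) (\det (diag_mx (e 1) *m A + B)).
    by exists (e 1); have [] := es 1 (or_intror erefl); split.
  exists (e (-1)); have [] := es (-1) (or_introl erefl); split=> //; lra.
have [d [dsign _ detd]] := partial n.
by exists d => // i; apply: dsign.
Qed.

(** * Eigenvalues of unitary matrices *)

(** A unitary matrix preserves the hermitian square of an eigenvector, while the
    eigenvalue multiplies it by its squared modulus. *)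
Lemma unitary_eigenvalue_norm {C : numClosedFieldType} {n : nat}
    {V : 'M[C]_n} {mu : C} :
  V \is unitarymx -> eigenvalue V mu -> `|mu| = 1.
Proof.
move=> /unitarymxP VV /eigenvalueP[v vV v0].
have vv : dotmx v v != 0 by rewrite gt_eqF // dotmx_is_dotmx.
have : `|mu| ^+ 2 * dotmx v v = dotmx v v.
  have -> : `|mu| ^+ 2 * dotmx v v = dotmx (mu *: v) (mu *: v).
    rewrite normCK !dotmxE linearZ /= map_mxZ -scalemxAl -scalemxAr scalerA.
    by rewrite [RHS]mxE.
  rewrite -vV.
  by rewrite !dotmxE trmx_mul map_mxM /= -mulmxA (mulmxA V) VV mul1mx.
by rewrite -{2}[dotmx v v]mul1r => /(mulIf vv)/eqP; rewrite sqrp_eq1 // => /eqP.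
Qed.

Lemma det_addr1_char_poly {C : comNzRingType} {n : nat} (V : 'M[C]_n) :
  \det (1%:M + V) = (-1) ^+ n * (char_poly V).[-1].
Proof.
rewrite -horner_evalE /char_poly -det_map_mx map_mxB -map_mx_comp.
rewrite (map_mx_id (f := horner_eval (-1) \o polyC)); last first.
  by move=> x; rewrite /= horner_evalE hornerC.
rewrite -detZ; congr (\det _); apply/matrixP=> i j.
by rewrite !mxE /= horner_evalE hornerMn hornerX mulN1r opprB mulNrn opprK addrC.
Qed.

(** Isolating the factor [1 + mu] in the product over all eigenvalues leaves
    [n - 1] factors of modulus at most 2, which accounts for
    [|1 + mu| >= 2 ^ (1 - n)]; this is stated without division. *)
Lemma unitary_eigenvalue_add1_ge {C : numClosedFieldType} {n : nat} {V : 'M[C]_n}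
    {mu : C} :
  V \is unitarymx -> 1 <= `|\det (1%:M + V)| -> eigenvalue V mu ->
  2 <= `|1 + mu| * 2 ^+ n.
Proof.
move=> Vu Vdet Vmu.
have [r rE] := closed_field_poly_normal (char_poly V).
move: (rE); rewrite (monicP (char_poly_monic V)) scale1r => charE.
have size_r : size r = n.
  by have := size_char_poly V; rewrite charE size_prod_XsubC => -[].
have r_eigen x : x \in r -> eigenvalue V x.
  by rewrite eigenvalue_root_char charE root_prod_XsubC.
have mur : mu \in r.
  by move: Vmu; rewrite eigenvalue_root_char charE root_prod_XsubC.
have detE : `|\det (1%:M + V)| = \prod_(x <- r) `|1 + x|.
  rewrite det_addr1_char_poly normrM normrX normrN1 expr1n mul1r charE.
  rewrite horner_prod normr_prod; apply: eq_bigr => x _.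
  by rewrite hornerXsubC -opprD normrN.
have n_gt0 : (0 < n)%N by rewrite -size_r; case: (r) mur.
have rem_le : \prod_(x <- rem mu r) `|1 + x| <= 2 ^+ n.-1.
  have -> : 2 ^+ n.-1 = \prod_(x <- rem mu r) (2 : C).
    by rewrite big_const_seq count_predT iter_mulr_1 size_rem // size_r.
  rewrite [X in X <= _]big_seq [X in _ <= X]big_seq.
  apply: ler_prod => x /mem_rem /r_eigen xV.
  rewrite normr_ge0 (le_trans (ler_normD _ _)) //.
  by rewrite normr1 (unitary_eigenvalue_norm Vu xV).
rewrite -(prednK n_gt0) exprS mulrCA -[X in X <= _]mulr1 ler_pM2l //.
apply: le_trans Vdet _; rewrite detE (big_rem mu) //=.
by rewrite ler_wpM2l.
Qed.

(** * Entries of the inverse *)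

Lemma det_norm_le {R : numDomainType} {n : nat} {A : 'M[R]_n} {K : R} :
  (forall i j, `|A i j| <= K) -> `|\det A| <= n`!%:R * K ^+ n.
Proof.
move=> AK; apply: le_trans (ler_norm_sum _ _ _) _.
rewrite mulr_natl -card_Sn -sumr_const; apply: ler_sum => s _.
rewrite normrM normrX normrN1 expr1n mul1r normr_prod.
rewrite -[n in K ^+ n]card_ord -prodr_const.
by apply: ler_prod => i _; rewrite normr_ge0 AK.
Qed.

(** Cramer's rule: an entry of the inverse is a cofactor, a determinant of order
    [n - 1], divided by the determinant. *)
Lemma invmx_norm_le {R : numFieldType} {n : nat} {A : 'M[R]_n} {K : R} i j :
  (forall i j, `|A i j| <= K) -> 1 <= `|\det A| ->
  `|invmx A i j| <= n.-1`!%:R * K ^+ n.-1.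
Proof.
move=> AK detA.
have Au : A \in unitmx.
  by rewrite unitmxE unitfE -normr_gt0 (lt_le_trans _ detA).
rewrite /invmx Au !mxE /cofactor !normrM normrX normrN1 expr1n mul1r normfV.
rewrite ler_pdivrMl; last exact: lt_le_trans detA.
apply: (@le_trans _ _ (n.-1`!%:R * K ^+ n.-1)).
  by apply: det_norm_le => k l; rewrite !mxE.
by rewrite ler_peMl // mulr_ge0 // exprn_ge0 // (le_trans _ (AK i j)).
Qed.

(** * The Cayley transform of an orthogonal matrix *)

Section Cayley.
Context {R : realType} {n : nat}.
Implicit Types U D V : 'M[R]_n.

Lemma orthogonal_signature_mul U D :
  orthogonal_group R n U -> signature_matrix R n D ->
  orthogonal_group R n (D *m U).
Proof.
move=> [UU _] [/diag_mxP[d ->] dsign].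
have DD : diag_mx d *m (diag_mx d)^T = 1%:M.
  apply/matrixP => i j; rewrite tr_diag_mx mul_diag_mx !mxE.
  have := dsign i; rewrite !mxE eqxx mulr1n.
  case: (i == j); rewrite ?mulr0 // mulr1n.
  by case=> ->; rewrite ?mulrNN mulr1.
have VV : diag_mx d *m U *m (diag_mx d *m U)^T = 1%:M.
  by rewrite trmx_mul mulmxA -(mulmxA _ U) UU mulmx1.
by split=> //; exact: mulmx1C.
Qed.

Lemma orthogonal_entry_le V i j : orthogonal_group R n V -> `|V i j| <= 1.
Proof.
move=> [/matrixP/(_ i i) + _]; rewrite !mxE eqxx => VV.
rewrite -(@expr_le1 _ 2) // -normrX ger0_norm ?sqr_ge0 //.
rewrite -[X in _ <= X]/(true%:R) -VV.
rewrite (bigD1 j) //= mxE -expr2 lerDl sumr_ge0 // => k _.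
by rewrite mxE -expr2 sqr_ge0.
Qed.

Lemma orthogonal_unitary V :
  orthogonal_group R n V -> map_mx (real_complex R) V \is unitarymx.
Proof.
move=> [VV _]; apply/unitarymxP.
have -> : map_mx Num.conj (map_mx (real_complex R) V)^T =
    map_mx (real_complex R) V^T.
  apply/matrixP => i j; rewrite !mxE; apply/CrealP.
  by apply/complex_realP; exists (V j i).
by rewrite -map_mxM VV map_mx1.
Qed.

(** Since [V^T] inverts [V], the products [(1 + V^T) (1 - V)] and
    [(1 - V^T) (1 + V)] reduce to the opposite matrices [V^T - V] and [V - V^T]. *)
Lemma cayley_skew V :
  orthogonal_group R n V -> 1%:M + V \in unitmx -> cayley V \is skewmx.
Proof.
move=> [VV VV'] Vu.
have V1u : 1%:M + V^T \in unitmx by rewrite -unitmx_tr linearD /= trmx1 trmxK.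
apply/is_hermitianmxP; rewrite map_mx_id // expr1 scaleN1r /cayley.
have trD : (1%:M + V)^T = 1%:M + V^T by rewrite linearD /= trmx1.
have trB : (1%:M - V)^T = 1%:M - V^T by rewrite linearB /= trmx1.
rewrite trmx_mul trmx_inv trD trB.
(* multiply by 1 + V^T on the left and 1 + V on the right *)
apply: (can_inj (mulmxK Vu)); apply: (can_inj (mulKmx V1u)).
rewrite mulmxKV // mulNmx mulmxN !mulmxA mulmxV // mul1mx.
rewrite !(mulmxDl, mulmxDr, mulmx1, mul1mx, mulmxN, mulNmx) VV'.
by apply/matrixP => i j; rewrite !mxE; ring.
Qed.

(** Writing [1 - V = 2 - (1 + V)] turns [C(V)] into [2 (1 + V)^-1 - 1], so only
    the entries of the inverse matter. *)
Lemma cayley_entry_le V i j :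
  orthogonal_group R n V -> 1 <= `|\det (1%:M + V)| ->
  `|cayley V i j| <= 2 * (n.-1`!%:R * 2 ^+ n.-1) + 1.
Proof.
move=> Vo Vdet.
have Vu : 1%:M + V \in unitmx.
  by rewrite unitmxE unitfE -normr_gt0 (lt_le_trans _ Vdet).
have one_le (k l : 'I_n) : `|(1%:M : 'M[R]_n) k l| <= 1.
  by rewrite mxE; case: (k == l); rewrite ?normr1 ?normr0.
have -> : cayley V = 2 *: invmx (1%:M + V) - 1%:M.
  apply: (can_inj (mulmxK Vu)); rewrite /cayley mulmxKV // mulmxBl mul1mx.
  by rewrite -scalemxAl mulVmx // scaler_nat mulr2n opprD addrA addrK.
rewrite !mxE (le_trans (ler_normD _ _)) // lerD //.
  rewrite normrM ger0_norm // ler_wpM2l //.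
  apply: invmx_norm_le => // k l; rewrite mxE (le_trans (ler_normD _ _)) //.
  by rewrite lerD // ?one_le ?orthogonal_entry_le.
by rewrite normrN; have := one_le i j; rewrite mxE.
Qed.

(** The relation [1 + z = 2 / (1 + mu)] exchanges the lower bound on [|1 + mu|]
    for an upper bound on [|1 + z|]. *)
Lemma cayley_spectral_radius_le V :
  orthogonal_group R n V -> 1 <= `|\det (1%:M + V)| ->
  spectral_radius (cayley V) <= 1 + 2 ^+ n.
Proof.
move=> Vo Vdet; rewrite /spectral_radius; set S := (X in sup X).
(* the spectrum is empty when n = 0 *)
have [->|/set0P S0] := eqVneq S set0.
  by rewrite sup0 addr_ge0 // exprn_ge0.
apply: ge_sup S0 _ => _ [z zC <-]; move: zC => /eigenvalueP[v vC v0].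
rewrite -lecR rmorphD rmorphXn /= rmorph1 -[X in X <= _]/(`|z|) rmorph_nat.
set W := map_mx (real_complex R) V.
have Wu : 1%:M + W \in unitmx.
  rewrite -(map_mx1 (real_complex R)) -map_mxD map_unitmx unitmxE unitfE.
  by rewrite -normr_gt0 (lt_le_trans _ Vdet).
have Wdet : 1 <= `|\det (1%:M + W)|.
  rewrite -(map_mx1 (real_complex R)) -map_mxD det_map_mx.
  rewrite normc_def /= expr0n addr0 sqrtr_sqr.
  by rewrite -[1]/((1 : R)%:C)%C lecR.
(* clearing the inverse in the eigenvector equation gives
   z v (1 + W) = v (1 - W), which exhibits v as an eigenvector of W *)
have vW : (1 + z) *: (v *m W) = (1 - z) *: v.
  have : z *: (v *m (1%:M + W)) = v *m (1%:M - W).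
    rewrite scalemxAl -vC /cayley map_mxM map_invmx map_mxB map_mxD map_mx1.
    by rewrite -mulmxA mulmxKV.
  rewrite mulmxDr mulmxBr mulmx1 scalerDr !scalerDl scaleNr !scale1r => E.
  by rewrite addrC -[z *: (v *m W)](addKr (z *: v)) E addrCA addrA subrK addrC.
(* z = -1 would turn that equation into 0 = 2 v *)
have z1 : 1 + z != 0.
  apply/eqP => z1; move: vW; rewrite z1 scale0r => /esym/eqP.
  rewrite scaler_eq0 (negbTE v0) orbF.
  have -> : 1 - z = 2 - (1 + z) by ring.
  by rewrite z1 subr0 pnatr_eq0.
have mu : eigenvalue W ((1 - z) / (1 + z)).
  apply/eigenvalueP; exists v => //.
  by rewrite mulrC -scalerA -vW scalerA mulVf // scale1r.
have := unitary_eigenvalue_add1_ge (orthogonal_unitary _ Vo) Wdet mu.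
have -> : 1 + (1 - z) / (1 + z) = 2 / (1 + z) by field.
rewrite normf_div normr_nat -mulrA ler_pMr // ler_pdivlMl ?normr_gt0 // mulr1.
move=> z1_le; have -> : z = (1 + z) - 1 by ring.
by rewrite (le_trans (ler_normB _ _)) // normr1 addrC lerD2l.
Qed.

Lemma bounded_set_entries (B : set 'M[R]_n) (M : R) :
  (forall A i j, B A -> `|A i j| <= M) -> 0 <= M -> bounded_set B.
Proof.
move=> BM M0; exists M; split=> [|x /ltW Mx A BA /=]; first exact: num_real.
apply: le_trans Mx; rewrite -[`|A|]/(mx_norm A) mx_normrE.
by apply/bigmax_leP; split=> // -[i j] _ /=; exact: BM.
Qed.

End Cayley.

Theorem theorem3 (R : realType) (n : nat) :
  (forall U : 'M[R]_n, orthogonal_group R n U ->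
     exists D : 'M[R]_n,
       signature_matrix R n D /\ 1 <= `|\det (D *m U + 1%:M)|) /\
  (exists B : set 'M[R]_n,
     [/\ B `<=` so R n,
         bounded_set B
       & forall U D : 'M[R]_n,
           orthogonal_group R n U ->
           signature_matrix R n D ->
           1 <= `|\det (D *m U + 1%:M)| ->
           [/\ 1%:M + D *m U \in unitmx,
               B (cayley (D *m U))
             & spectral_radius (cayley (D *m U)) <= 1 + 2 ^+ n]]) /\
  (forall piv : 'M[R]_n -> 'M[R]_n, pivot_choice piv ->
     pivoted_cayley piv @` orthogonal_group R n `<=` so R n /\
     bounded_set (pivoted_cayley piv @` orthogonal_group R n)).
Proof.
pose M : R := 2 * (n.-1`!%:R * 2 ^+ n.-1) + 1.
have M0 : 0 <= M by rewrite addr_ge0 // !mulr_ge0 // exprn_ge0.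
pose B : set 'M[R]_n := [set A | A \is skewmx /\ forall i j, `|A i j| <= M].
have Bso : B `<=` so R n by move=> A [].
have Bbnd : bounded_set B.
  by apply: (@bounded_set_entries _ _ _ M) => // A i j [_]; exact.
have pivotP (U D : 'M[R]_n) : orthogonal_group R n U ->
    signature_matrix R n D -> 1 <= `|\det (D *m U + 1%:M)| ->
    [/\ 1%:M + D *m U \in unitmx, B (cayley (D *m U))
      & spectral_radius (cayley (D *m U)) <= 1 + 2 ^+ n].
  move=> Uo Ds; rewrite addrC => det1.
  have Vo := orthogonal_signature_mul _ _ Uo Ds.
  have Vu : 1%:M + D *m U \in unitmx.
    by rewrite unitmxE unitfE -normr_gt0 (lt_le_trans _ det1).
  split=> //; last exact: cayley_spectral_radius_le.
  split; first exact: cayley_skew.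
  by move=> i j; exact: cayley_entry_le.
split.
  move=> U _; have [d dsign] := @det_sign_pivot R n U 1%:M.
  rewrite det1 => detd; exists (diag_mx d); split.
    by split=> [|i]; [exact: diag_mx_is_diag | rewrite mxE eqxx mulr1n].
  exact: le_trans detd (ler_norm _).
split; first by exists B.
move=> piv pivO.
have imB : pivoted_cayley piv @` orthogonal_group R n `<=` B.
  move=> _ [U Uo <-]; have [Ds det1] := pivO _ Uo.
  by have [] := pivotP U _ Uo Ds det1.
split; first exact: subset_trans imB Bso.
by apply: (@bounded_set_entries _ _ _ M) => // A i j /imB[_]; exact.
Qed.
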